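(* For every real $p\ge 3$ and every integer $n\ge 1$, $$A_{p,n}=A_{p,n}(\mathrm{Haar})=A_{p,n}(\mathrm{Rademacher})=\left\|\frac{1}{\sqrt n}\sum_{k=1}^n r_k\right\|_p,$$ where $r_k$ are the Rademacher functions.
   Context: All random variables are real-valued. Let $(X,\mathscr F,\mu)$ be a probability space. A discrete filtration is an increasing sequence of $\sigma$-algebras $\mathscr F_0\subset\mathscr F_1\subset\dots\subset\mathscr F$ such that each $\mathscr F_k$ is generated by a finite or countable partition $\mathscr D_k$ of $X$ into disjoint measurable sets of positive measure, where $\mathscr D_0=\{X\}$ and every set in $\mathscr D_k$ is a union of elements of $\mathscr D_{k+1}$. A (discrete) martingale-difference sequence $d=\{d_1,\dots,d_n\}$ with respect to such a filtration is a sequence of integrable random variables with $d_k$ being $\mathscr F_k$-measurable and $\int_V d_k\,d\mu=0$ for every $V\in\mathscr D_{k-1}$, $k=1,\dots,n$. Its square function is $$\mathfrak S(d)(x)=\Big(\sum_{k=1}^n |D_k(x)|^2\Big)^{1/2},\qquad D_k(x)=\sum_{V\in\mathscr D_{k-1}}\|\mathbf 1_V d_k\|_\infty\,\mathbf 1_V(x).$$ It depends on the partitions as well as on the $d_k$. Define $$A_{p,n}=\sup_{d}\frac{\left\|\sum_{k=1}^n d_k\right\|_p}{\|\mathfrak S(d)\|_\infty},$$ the supremum being over all probability spaces, all discrete filtrations and all non-trivial martingale-difference sequences $d=\{d_1,\dots,d_n\}$ with exactly $n$ elements (non-trivial and such that the ratio makes sense: $0<\|\mathfrak S(d)\|_\infty<\infty$).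 $A_{p,n}(\mathrm{Haar})$ is the same supremum restricted to Haar martingales: $X=[0,1)$ with Lebesgue measure, $\mathscr D_k$ is the family of the $2^k$ dyadic intervals $[(j-1)/2^k,j/2^k)$, $1\le j\le 2^k$, and $d_k=\sum_{j=2^{k-1}+1}^{2^k}a_jh_j$ with real coefficients $a_j$, where, for $m=2^k+j$, $k\ge 0$, $1\le j\le 2^k$, the Haar function is $h_m=\mathbf 1_{[\frac{j-1}{2^k},\frac{2j-1}{2^{k+1}})}-\mathbf 1_{[\frac{2j-1}{2^{k+1}},\frac{j}{2^k})}$. (In this case $D_k=|d_k|$.) $A_{p,n}(\mathrm{Rademacher})$ is the same supremum further restricted to Rademacher martingales: $d_k=a_kr_k$ with real numbers $a_k$, with the same dyadic partitions of $[0,1)$, where $r_k(x)=\operatorname{sign}\sin(2^k\pi x)$, $k\ge1$, are the Rademacher functions on $[0,1)$ (independent, taking values $\pm1$ with probability $1/2$ each). In this case $\mathfrak S(d)=(\sum_{k=1}^n a_k^2)^{1/2}$. *)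

(* Defs.v *)
From HB Require Import structures.
From mathcomp Require Import all_boot all_order all_algebra.
From mathcomp Require Import all_classical all_reals all_analysis.

Set Implicit Arguments.
Unset Strict Implicit.
Unset Printing Implicit Defensive.

Import Order.TTheory GRing.Theory Num.Theory.
Import numFieldNormedType.Exports.

Local Open Scope classical_set_scope.
Local Open Scope ring_scope.
Local Open Scope ereal_scope.

Section discrete_martingales.
Context {d : measure_display} {T : measurableType d} {R : realType}.
Variable P : probability T R.

Definition pos_partition (D : set (set T)) : Prop :=
  [/\ countable D,
      forall V, D V -> measurable V /\ 0 < P V,
      \bigcup_(V in D) V = [set: T] &
      trivIset D id].

(* The filtration is given by the partitions: its k-th sigma-algebra is
   <<s D k >>, the one generated by D k. *)
Definition discrete_filtration (D : nat -> set (set T)) : Prop :=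
  [/\ forall k, pos_partition (D k),
      D 0%N = [set [set: T]] &
      forall k V, D k V ->
        exists2 E, E `<=` D k.+1 & V = \bigcup_(W in E) W].

(* Only the terms f 1, ..., f n of f : nat -> T -> R are relevant. *)
Definition mart_diff_seq (D : nat -> set (set T)) (n : nat)
    (f : nat -> T -> R) : Prop :=
  forall k, (1 <= k <= n)%N ->
    [/\ P.-integrable [set: T] (EFin \o f k),
        @measurable_fun _ _ (g_sigma_algebraType (D k)) R [set: T] (f k) &
        forall V, D k.-1 V -> \int[P]_(x in V) (f k x)%:E = 0].

Definition majorant (D : nat -> set (set T)) (f : nat -> T -> R) (k : nat)
    (x : T) : \bar R :=
  \esum_(V in D k.-1)
    ('N[P]_+oo[(fun y => (\1_V y * f k y)%:E)] * (\1_V x)%:E).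

Definition square_function (D : nat -> set (set T)) (n : nat)
    (f : nat -> T -> R) (x : T) : \bar R :=
  sqrte (\sum_(1 <= k < n.+1) majorant D f k x ^+ 2).

Definition mart_ratio (p : R) (D : nat -> set (set T)) (n : nat)
    (f : nat -> T -> R) : \bar R :=
  'N[P]_p%:E[(fun x => (\sum_(1 <= k < n.+1) f k x)%:E)]
    / 'N[P]_+oo[square_function D n f].

(* The ratios of the sequences in C for which the ratio makes sense. *)
Definition mart_ratios (p : R) (D : nat -> set (set T)) (n : nat)
    (C : set (nat -> T -> R)) : set (\bar R) :=
  [set mart_ratio p D n f |
    f in [set f | C f /\ 0 < 'N[P]_+oo[square_function D n f] < +oo]].

End discrete_martingales.

Definition A_const (R : realType) (p : R) (n : nat) : \bar R :=
  ereal_sup [set r | exists (d : measure_display) (T : measurableType d)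
    (P : probability T R) (D : nat -> set (set T)),
    discrete_filtration P D /\
    mart_ratios P p D n [set f | mart_diff_seq P D n f] r].

(* The probability space [0, 1) with Lebesgue measure, as a type. *)
Definition unitI (R : realType) : Type := {x : R | x \in `[0%R, 1%R[}.

Section unit_interval.
Variable R : realType.

HB.instance Definition _ := Choice.on (unitI R).

Definition unitI_val (x : unitI R) : measurableTypeR R := \val x.

Fact unitI0_subproof : (0 : R)%R \in `[0%R, 1%R[.
Proof. by rewrite in_itv /= lexx ltr01. Qed.

HB.instance Definition _ :=
  isPointed.Build (unitI R) (exist _ 0%R unitI0_subproof).

(* measurable sets: the traces on [0, 1) of the Borel sets *)
HB.instance Definition _ :=
  Measurable.copy (unitI R) (g_sigma_algebra_preimageType unitI_val).

Definition unitI_prob (A : set (unitI R)) : \bar R :=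
  @lebesgue_measure R (unitI_val @` A).

Let unitI_val_inj : injective unitI_val.
Proof. by move=> x y /val_inj. Qed.

Let image_unitI_val (B : set (measurableTypeR R)) :
  unitI_val @` (unitI_val @^-1` B) = B `&` `[0%R, 1%R[.
Proof.
apply/seteqP; split=> [_ [x Bx <-]|x [Bx x01]].
  by split=> //; exact: (valP x).
by exists (exist _ x x01).
Qed.

Let measurable_image (A : set (unitI R)) :
  measurable A -> measurable (unitI_val @` A).
Proof.
move=> [B mB <-]; rewrite setTI image_unitI_val.
by apply: measurableI => //; exact: measurable_itv.
Qed.

Let unitI_prob0 : unitI_prob set0 = 0.
Proof. by rewrite /unitI_prob image_set0 measure0. Qed.

Let unitI_prob_ge0 A : 0 <= unitI_prob A.
Proof. exact: measure_ge0. Qed.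

Let unitI_prob_sigma_additive : semi_sigma_additive unitI_prob.
Proof.
move=> F mF tF mUF; rewrite /unitI_prob image_bigcup.
apply: (@measure_semi_sigma_additive _ _ _ (@lebesgue_measure R)
  (fun n => unitI_val @` F n)).
- by move=> n; exact: measurable_image.
- move=> i j _ _ [_ [[x Fx <-] [y Fy /unitI_val_inj yx]]].
  by apply: tF => //; exists x; split=> //; rewrite -yx.
- by rewrite -image_bigcup; exact: measurable_image.
Qed.

HB.instance Definition _ := isMeasure.Build _ _ _ unitI_prob
  unitI_prob0 unitI_prob_ge0 unitI_prob_sigma_additive.

Let unitI_prob_setT : unitI_prob [set: unitI R] = 1.
Proof.
rewrite /unitI_prob -(preimage_setT unitI_val) image_unitI_val setTI.
by rewrite lebesgue_measure_itv /= lte_fin ltr01 oppr0 adde0.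
Qed.

HB.instance Definition _ :=
  Measure_isProbability.Build _ _ _ unitI_prob unitI_prob_setT.

End unit_interval.

Section haar_rademacher.
Variable R : realType.
Implicit Types (k j m : nat) (a : nat -> R).

Local Open Scope ring_scope.

Definition unitI_Ico (u v : R) : set (unitI R) :=
  [set x | u <= unitI_val x < v].

Definition dyadic k : set (set (unitI R)) :=
  [set unitI_Ico (j.-1%:R / 2 ^+ k) (j%:R / 2 ^+ k) |
    j in [set j | (1 <= j <= 2 ^ k)%N]].

Definition haar_fun k j (x : unitI R) : R :=
  \1_(unitI_Ico (j.-1%:R / 2 ^+ k) ((2 * j).-1%:R / 2 ^+ k.+1)) x
  - \1_(unitI_Ico ((2 * j).-1%:R / 2 ^+ k.+1) (j%:R / 2 ^+ k)) x.

(* Every m >= 2 is 2 ^ k + j for exactly one k >= 0 and 1 <= j <= 2 ^ k,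
   namely k = trunc_log 2 (m - 1); see haarE. *)
Definition haar m : unitI R -> R :=
  let k := trunc_log 2 m.-1 in haar_fun k (m - 2 ^ k).

Lemma haarE k j : (1 <= j <= 2 ^ k)%N -> haar (2 ^ k + j) = haar_fun k j.
Proof.
move=> /andP[j1 jk]; rewrite /haar.
have -> : trunc_log 2 (2 ^ k + j).-1 = k; last by rewrite addKn.
apply: trunc_log_eq => //; apply/andP; split.
  by rewrite -ltnS prednK ?addn_gt0 ?j1 ?orbT// -addn1 leq_add2l.
by rewrite expnS mul2n -addnn -ltnS prednK ?addn_gt0 ?j1 ?orbT// ltnS leq_add2l.
Qed.

Definition haar_mart a k (x : unitI R) : R :=
  \sum_((2 ^ k.-1).+1 <= m < (2 ^ k).+1) a m * haar m x.

(* The value 0 at the finitely many zeros of the sine is irrelevant to the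
   norms and the square function, which only depend on a.e. classes. *)
Definition rademacher k (x : unitI R) : R :=
  Num.sg (sin (2 ^+ k * pi * unitI_val x)).

Definition rademacher_mart a k (x : unitI R) : R := a k * rademacher k x.

End haar_rademacher.

Definition A_Haar (R : realType) (p : R) (n : nat) : \bar R :=
  ereal_sup
    (mart_ratios (@unitI_prob R) p (@dyadic R) n (range (@haar_mart R))).

Definition A_Rademacher (R : realType) (p : R) (n : nat) : \bar R :=
  ereal_sup
    (mart_ratios (@unitI_prob R) p (@dyadic R) n (range (@rademacher_mart R))).

(* Main.v *)
Require Import Defs.
From mathcomp Require Import all_boot all_order all_algebra.
From mathcomp Require Import all_classical all_reals all_analysis.
From mathcomp Require Import measurable_realfun ess_sup_inf.
From mathcomp Require Import ring lra.

(* Let [D_k] be the majorant of [|d_k|]. Replacing the increments by signs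
   can only increase a moment: on an atom [V] of the (k-1)-th partition
   everything but [d_k] is constant, and a convex [G] lies below its chord on
   [s - D_k, s + D_k], so [\int_V G (s + d_k)] is at most [P V] times the mean of
   [G (s + D_k)] and [G (s - D_k)]. Going backwards, it remains to distribute
   the total variance [t] among [n] independent signs, and equal shares are the
   best choice for [G x = |x|^p] with [p >= 3]: for
   [psi z = |x + z|^p + |x - z|^p] the quotient [psi' z / z] is nondecreasing
   because [psi'] is convex, so [psi] is convex as a function of [z^2], and
   [psi (a + b) + psi (a - b)] with [a^2 + b^2] fixed increases with [a * b].
   Hence the supremum is reached by the normalized Rademacher sum, which is
   almost everywhere a Haar martingale. *)

Set Implicit Arguments.
Unset Strict Implicit.
Unset Printing Implicit Defensive.

Import Order.TTheory GRing.Theory Num.Theory.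
Import numFieldNormedType.Exports.

Local Open Scope classical_set_scope.
Local Open Scope ring_scope.

(** * The optimal distribution of the variance *)

Section signed_powers.
Variable R : realType.
Implicit Types (a b p w x y z q df : R) (f : R -> R).

Lemma is_derive_ge0_le f (df : R -> R) a b : a <= b ->
  (forall x, is_derive x 1 f (df x)) ->
  (forall x, a < x < b -> 0 <= df x) -> f a <= f b.
Proof.
move=> ab fdf df0; apply: (@ger0_derive1_le_cc _ f a b) => //.
- by move=> x; rewrite in_itv => xab; rewrite derive1E derive_val df0.
- apply: continuous_subspaceT => x.
  exact/differentiable_continuous/derivable1_diffP.
- by rewrite in_itv/= lexx.
- by rewrite in_itv/= lexx ab.
Qed.

Lemma is_derive_le_sqr f : f 0 = 0 ->
  (forall h, `|h| <= 1 -> `|f h| <= h ^+ 2) -> is_derive (0 : R) 1 f 0.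
Proof.
move=> f0 fh.
have cf : h^-1 *: (f (h *: 1 + 0) - f 0) @[h --> 0^'] --> (0 : R).
  apply/cvgrPdist_le => e e0; near=> h.
  have h0 : h != 0 by near: h; exact: nbhs_dnbhs_neq.
  have h1 : `|h| <= 1.
    near: h; apply: dnbhs0_le; exact: ltr01.
  have he : `|h| <= e by near: h; exact: dnbhs0_le.
  rewrite sub0r normrN f0 subr0 addr0 /GRing.scale/= mulr1 normrM normfV.
  rewrite ler_pdivrMl ?normr_gt0//.
  apply: le_trans (fh _ h1) _.
  by rewrite -real_normK ?num_real// expr2 ler_wpM2l.
by apply: DeriveDef; [apply/cvg_ex; exists 0|exact: cvg_lim].
Unshelve. all: by end_near. Qed.

Lemma is_derive_norm_powR q y : 2 <= q ->
  is_derive y 1 (fun z => `|z| `^ q) (q * (Num.sg y * `|y| `^ (q - 1))).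
Proof.
move=> q2; have [y0|y0|->] := ltgtP y 0.
- rewrite ltr0_sg// ltr0_norm// mulN1r mulrN.
  apply: (@near_eq_is_derive _ _ _ ((@powR R ^~ q) \o -%R)).
    by near=> z; rewrite /= ltr0_norm//; near: z; exact: lt_nbhsl.
  rewrite -[X in is_derive _ _ _ X]mulrN1; apply: is_derive1_comp.
  by apply: is_derive1_powR; rewrite oppr_gt0.
- rewrite gtr0_sg// gtr0_norm// mul1r.
  apply: (@near_eq_is_derive _ _ _ (@powR R ^~ q)).
    by near=> z; rewrite /= gtr0_norm//; near: z; exact: lt_nbhsr.
  exact: is_derive1_powR.
- rewrite sgr0 mul0r mulr0; apply: is_derive_le_sqr.
    by rewrite normr0 powR0//; lra.
  move=> h h1; rewrite ger0_norm ?powR_ge0// -real_normK ?num_real//.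
  have [->|h0] := eqVneq h 0; first by rewrite normr0 powR0 ?expr0n//; lra.
  by rewrite -powR_mulrn// ger_powR// normr_gt0 h0.
Unshelve. all: by end_near. Qed.

Lemma is_derive_sg_powR q y : 2 <= q ->
  is_derive y 1 (fun z => Num.sg z * `|z| `^ q) (q * `|y| `^ (q - 1)).
Proof.
move=> q2; have [y0|y0|->] := ltgtP y 0.
- rewrite ltr0_norm//.
  apply: (@near_eq_is_derive _ _ _ (- ((@powR R ^~ q) \o -%R))).
    near=> z; have z0 : z < 0 by near: z; exact: lt_nbhsl.
    by rewrite /= ltr0_norm// ltr0_sg// mulN1r.
  rewrite (_ : q * _ = - (q * (- y) `^ (q - 1) * -1)); last by rewrite mulrN1 opprK.
  apply: is_deriveN.
  apply: is_derive1_comp.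
  by apply: is_derive1_powR; rewrite oppr_gt0.
- rewrite gtr0_norm//.
  apply: (@near_eq_is_derive _ _ _ (@powR R ^~ q)).
    near=> z; have z0 : 0 < z by near: z; exact: lt_nbhsr.
    by rewrite /= gtr0_norm// gtr0_sg// mul1r.
  exact: is_derive1_powR.
- rewrite normr0 powR0 ?mulr0; last by lra.
  apply: is_derive_le_sqr; first by rewrite sgr0 mul0r.
  move=> h h1; have [->|h0] := eqVneq h 0.
    by rewrite sgr0 mul0r normr0 expr0n.
  rewrite normrM normr_sg h0 mul1r ger0_norm ?powR_ge0// -real_normK ?num_real//.
  by rewrite -powR_mulrn// ger_powR// normr_gt0 h0.
Unshelve. all: by end_near. Qed.

(** The point [x + d] is the convex combination of [x + D] and [x - D] with weights
    [(D + d) / (2 * D)] and [(D - d) / (2 * D)]. Clearing the denominator includes the case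
    [D = 0]. *)
Lemma convex_norm_powR q x d D : 1 <= q -> `|d| <= D ->
  2 * D * `|x + d| `^ q <=
    (D + d) * `|x + D| `^ q + (D - d) * `|x - D| `^ q.
Proof.
move=> q1; rewrite ler_norml => /andP[dD1 dD2].
have [D0|D0] := eqVneq D 0.
  have -> : d = 0 by lra.
  by rewrite D0; lra.
have D_gt0 : 0 < D by lra.
have [t t01 tE] : exists2 t : R, 0 <= t <= 1 & 2 * D * t = D + d.
  exists ((D + d) / (2 * D)); last by field.
  by rewrite ler_pdivrMr ?mulr_gt0// mul1r divr_ge0//=; lra.
have tE' : 2 * D * (1 - t) = D - d by lra.
rewrite -tE -tE' -!mulrA -!mulrDr !mulrA ler_wpM2l//; first by lra.
have nt : `|t| = t by rewrite ger0_norm//; lra.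
have nt' : `|1 - t| = 1 - t by rewrite ger0_norm//; lra.
apply: (@le_trans _ _ ((t * `|x + D| + (1 - t) * `|x - D|) `^ q)).
  apply: ge0_ler_powR; rewrite ?nnegrE//; first by lra.
    by rewrite addr_ge0// mulr_ge0//; lra.
  rewrite (_ : x + d = t * (x + D) + (1 - t) * (x - D)); last by lra.
  by rewrite (le_trans (ler_normD _ _))// !normrM nt nt'.
have /andP[t0 t1] := t01.
have := @convex_powR R q q1 (Itv01 t0 t1) `|x + D| `|x - D|.
rewrite !inE/= !in_itv/= !normr_ge0 => /(_ isT isT).
by rewrite !convRE.
Qed.

(** Add the convexity inequalities for [d = w] and [d = - w]. It is applied with the exponent
    [p - 2], which is at least 1 because [3 <= p]. *)
Lemma norm_powR_sym_le q x w z : 1 <= q -> 0 <= w <= z ->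
  `|w + x| `^ q + `|w - x| `^ q <= `|z + x| `^ q + `|z - x| `^ q.
Proof.
move=> q1 /andP[w0 wz]; have [z0|z0] := eqVneq z 0.
  by have -> : w = z by lra.
have wz' : `|w| <= z by rewrite ger0_norm.
have := convex_norm_powR x q1 wz'.
rewrite -normrN in wz'; have := convex_norm_powR x q1 wz'.
rewrite [w + x]addrC [z + x]addrC (distrC w) (distrC z) opprK => H1 H2.
have z_gt0 : 0 < z by lra.
rewrite -(@ler_pM2l _ (2 * z)) ?mulr_gt0//. lra.
Qed.

(** For [q = p - 1], this is the derivative of [|z + x| ^ p + |z - x| ^ p] in [z], divided by
    [p]. *)
Let sg_powR_sum q x z := Num.sg (z + x) * `|z + x| `^ q +
                         Num.sg (z - x) * `|z - x| `^ q.

Lemma is_derive_shift1 f df x z :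
  is_derive (z + x) 1 f df -> is_derive z 1 (fun y => f (y + x)) df.
Proof.
move=> fdf; rewrite -[df]mulr1; apply: (@is_derive1_comp _ f (fun y => y + x)).
by apply: is_derive_eq; rewrite addr0.
Qed.

Let is_derive_sg_powR_sum q x z : 2 <= q -> is_derive z 1 (sg_powR_sum q x)
  (q * (`|z + x| `^ (q - 1) + `|z - x| `^ (q - 1))).
Proof.
move=> q2; rewrite mulrDr; apply: is_deriveD.
  apply: (@is_derive_shift1 (fun z => Num.sg z * `|z| `^ q)).
  exact: is_derive_sg_powR.
apply: (@is_derive_shift1 (fun z => Num.sg z * `|z| `^ q)).
exact: is_derive_sg_powR.
Qed.

(* [sg_powR_sum q x] is convex on [0, +oo[ and vanishes at 0. *)
Let sg_powR_sum_slope q x w z : 2 <= q -> 0 <= w <= z ->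
  z * sg_powR_sum q x w <= w * sg_powR_sum q x z.
Proof.
move=> q2 /andP[w0 wz]; set N := sg_powR_sum q x.
pose dN y := q * (`|y + x| `^ (q - 1) + `|y - x| `^ (q - 1)).
have dN_le u v : 0 <= u <= v -> dN u <= dN v.
  by move=> uv; rewrite ler_wpM2l ?norm_powR_sym_le//; lra.
have N0 : N 0 = 0.
  rewrite /N /sg_powR_sum !add0r normrN sgrN mulNr; exact: subrr.
have dNP y : is_derive y 1 N (dN y) by exact: is_derive_sg_powR_sum.
(* The tangent of [N] at [w] takes a value at most [N 0 = 0] at the origin. Hence
   [w * N y - y * N w] has a nonnegative derivative in [y] beyond [w]. *)
have Nw : N w <= w * dN w.
  have : 0 * dN w - N 0 <= w * dN w - N w.
    apply: (@is_derive_ge0_le (fun y => y * dN w - N y) (fun y => dN w - dN y)).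
    - exact: w0.
    - by move=> y; apply: is_derive_eq; rewrite scaler0 add0r [_ *: _]mulr1.
    - by move=> y /andP[y0 yw]; rewrite subr_ge0 dN_le// !ltW.
  by rewrite N0 mul0r subr0 subr_ge0.
have : w * N w - w * N w <= w * N z - z * N w.
  apply: (@is_derive_ge0_le (fun y => w * N y - y * N w) (fun y => w * dN y - N w)).
  - exact: wz.
  - move=> y; apply: is_derive_eq.
    by rewrite scaler0 add0r [N w *: _]mulr1.
  - move=> y /andP[wy yz]; rewrite subr_ge0 (le_trans Nw)// ler_wpM2l// dN_le//.
    by rewrite w0 ltW.
by rewrite subrr subr_ge0.
Qed.


(* The function [z |-> `|z + x| `^ p + `|z - x| `^ p] is convex as a function
   of [z ^+ 2], because its derivative divided by [z] is nondecreasing. *)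
Lemma norm_powR_spread p x a b (a' b' : R) : 3 <= p -> 0 <= b' ->
  b' <= b -> b <= a -> a <= a' -> a ^+ 2 + b ^+ 2 = a' ^+ 2 + b' ^+ 2 ->
  (`|a + x| `^ p + `|a - x| `^ p) + (`|b + x| `^ p + `|b - x| `^ p) <=
  (`|a' + x| `^ p + `|a' - x| `^ p) + (`|b' + x| `^ p + `|b' - x| `^ p).
Proof.
move=> p3 b'0 b'b ba aa' abE.
have [a0|a_neq0] := eqVneq a 0.
  have b0 : b = 0 by lra.
  have b'0' : b' = 0 by lra.
  have /eqP : a' ^+ 2 = 0 by rewrite a0 b0 b'0' in abE; lra.
  by rewrite sqrf_eq0 => /eqP a'0; rewrite a0 b0 b'0' a'0.
have a_gt0 : 0 < a by lra.
pose psi z := `|z + x| `^ p + `|z - x| `^ p.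
pose N := sg_powR_sum (p - 1) x.
(* Up to scaling and a constant, [F] is [psi] minus its tangent at [a], both seen as functions of
   [z ^+ 2]. So [F] decreases before [a] and increases after it, and the quadratic terms cancel
   since the sums of squares agree. *)
pose F z := 2 * a * psi z - p * N a * z ^+ 2.
pose dF z := 2 * p * (a * N z - z * N a).
have dFP y : is_derive y 1 F (dF y).
  have dpsi : is_derive y 1 psi (p * N y).
    rewrite /N /sg_powR_sum mulrDr; apply: is_deriveD.
      apply: (@is_derive_shift1 (fun z => `|z| `^ p)).
      by apply: is_derive_norm_powR; lra.
    apply: (@is_derive_shift1 (fun z => `|z| `^ p)).
    by apply: is_derive_norm_powR; lra.
  apply: is_derive_eq; rewrite /dF /GRing.scale/=.
  by ring.
have Fa : F a <= F a'.
  apply: (is_derive_ge0_le aa' dFP) => y /andP[ay _].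
  rewrite /dF mulr_ge0 ?subr_ge0 ?sg_powR_sum_slope//; lra.
have Fb : - F b' <= - F b.
  apply: (@is_derive_ge0_le (- F) (- dF)) => //.
  move=> y /andP[ay yb]; rewrite oppr_ge0 /dF mulr_ge0_le0 ?subr_le0//; first by lra.
  by rewrite sg_powR_sum_slope//; lra.
rewrite -/(psi a) -/(psi b) -/(psi a') -/(psi b').
rewrite -(@ler_pM2l _ (2 * a)) ?mulr_gt0//.
have : p * N a * (a ^+ 2 + b ^+ 2) = p * N a * (a' ^+ 2 + b' ^+ 2) by rewrite abE.
by rewrite /F in Fa Fb; lra.
Qed.

End signed_powers.

(** * Averages over signs and equal distribution of the variance *)

Section balancing.
Variable R : realType.
Implicit Types (x a b c d D t p : R) (G : R -> R).

Definition sym_avg G D x : R := (G (x + D) + G (x - D)) / 2.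

(** Convexity at the points of [[x - D, x + D]], with denominators cleared so that the degenerate
    chord [D = 0] is allowed. *)
Definition chord_below G := forall x d D, `|d| <= D ->
  2 * D * G (x + d) <= (D + d) * G (x + D) + (D - d) * G (x - D).

(* [sym_avg (sym_avg G a) b x] is the mean of [G (x + a r_1 + b r_2)]. *)
Definition balancing G := forall x a b c d,
  0 <= a -> 0 <= b -> 0 <= c -> 0 <= d ->
  a ^+ 2 + b ^+ 2 = c ^+ 2 + d ^+ 2 -> a * b <= c * d ->
  sym_avg (sym_avg G a) b x <= sym_avg (sym_avg G c) d x.

Lemma sym_avgC G a b x : sym_avg (sym_avg G a) b x = sym_avg (sym_avg G b) a x.
Proof. by rewrite /sym_avg !(addrAC x a) !(addrAC x (- a)); lra. Qed.

Definition norm_pow p x := `|x| `^ p.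

Lemma norm_pow_ge0 p x : 0 <= norm_pow p x.
Proof. exact: powR_ge0. Qed.

(** The two averages involve the distances [a + b], [a - b] and [c + d], [c - d] from [x]. The
    hypotheses say that both pairs have the same sum of squares and that the second pair is more
    spread out. *)
Lemma balancing_norm_pow p : 3 <= p -> balancing (norm_pow p).
Proof.
move=> p3 x a b c d a0 b0 c0 d0 E abcd.
wlog ba : a b a0 b0 E abcd / b <= a.
  move=> H; have [|/ltW] := leP b a; first exact: H.
  move=> ab; have := H b a b0 a0; rewrite addrC [b * a]mulrC => /(_ E abcd ab).
  by rewrite [in leLHS]sym_avgC.
wlog dc : c d c0 d0 E abcd / d <= c.
  move=> H; have [|/ltW] := leP d c; first exact: H.
  move=> cd; have := H d c d0 c0.
  rewrite [_ + c ^+ 2]addrC [d * c]mulrC => /(_ E abcd cd).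
  by rewrite [in leRHS]sym_avgC.
have := @norm_powR_spread R p x (a + b) (a - b) (c + d) (c - d) p3.
rewrite /sym_avg /norm_pow; have H1 : a + b <= c + d.
  by rewrite -ler_sqr ?nnegrE ?addr_ge0// !sqrrD; lra.
have H2 : c - d <= a - b.
  by rewrite -ler_sqr ?nnegrE ?subr_ge0// !sqrrB; lra.
rewrite subr_ge0 => /(_ dc H2 _ H1).
have -> : a - b <= a + b by lra.
have -> : (a + b) ^+ 2 + (a - b) ^+ 2 = (c + d) ^+ 2 + (c - d) ^+ 2.
  by lra.
move=> /(_ isT erefl).
have e1 u v : `|u - v - x| = `|x + v - u|.
  by rewrite -normrN; congr (`|_|); ring.
have e2 u v : `|u + v + x| = `|x + v + u|.
  by congr (`|_|); ring.
have e3 u v : `|u + v - x| = `|x - v - u|.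
  by rewrite -normrN; congr (`|_|); ring.
have e4 u v : `|u - v + x| = `|x - v + u|.
  by congr (`|_|); ring.
rewrite !e1 !e4 !e3 !e2; lra.
Qed.

Lemma chord_below_norm_pow p : 1 <= p -> chord_below (norm_pow p).
Proof. by move=> p1 x d D dD; exact: convex_norm_powR. Qed.

Lemma chord_below_sym_avg G c : chord_below G -> chord_below (sym_avg G c).
Proof.
move=> cG x d D dD; rewrite /sym_avg.
have := cG (x + c) d D dD; have := cG (x - c) d D dD.
rewrite !(addrAC x d) !(addrAC x (- D)) !(addrAC x D); lra.
Qed.

Lemma sym_avg_le G F a x : (forall y, G y <= F y) -> sym_avg G a x <= sym_avg F a x.
Proof. by move=> GF; rewrite /sym_avg ler_pM2r// lerD. Qed.

Lemma eq_sym_avg G F a x : G =1 F -> sym_avg G a x = sym_avg F a x.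
Proof. by move=> GF; rewrite /sym_avg !GF. Qed.

(** Averages commute, so the one of size [e] can be taken last, where it is monotone. *)
Lemma balancing_sym_avg G e : balancing G -> balancing (sym_avg G e).
Proof.
move=> bG x a b c d a0 b0 c0 d0 E abcd.
have H u v y : sym_avg (sym_avg (sym_avg G e) u) v y =
    sym_avg (sym_avg (sym_avg G u) v) e y.
  by rewrite [RHS]sym_avgC; apply: eq_sym_avg => z; exact: sym_avgC.
by rewrite !H; apply: sym_avg_le => y; exact: bG.
Qed.

(* [rad_mean G m t s] is the mean of
   [G (s + Num.sqrt (t / m%:R) * \sum_(k < m) r_k)]: the quotient [t / m%:R]
   does not change when [(m, t)] becomes [(m - 1, t - t / m%:R)]. *)
Fixpoint rad_mean G m t : R -> R :=
  if m is m'.+1 then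
    let c := Num.sqrt (t / m%:R) in sym_avg (rad_mean G m' (t - t / m%:R)) c
  else G.

Lemma rad_mean_ge0 G m t x : (forall y, 0 <= G y) -> 0 <= rad_mean G m t x.
Proof.
move=> G0; elim: m t x => [|m IH] t x /=; first exact: G0.
by rewrite /sym_avg divr_ge0 ?addr_ge0.
Qed.

Lemma chord_below_rad_mean G m t : chord_below G -> chord_below (rad_mean G m t).
Proof. by move=> cG; elim: m t => // m IH t; exact: chord_below_sym_avg. Qed.

Lemma balancing_rad_mean G m t : balancing G -> balancing (rad_mean G m t).
Proof. by move=> bG; elim: m t => // m IH t; exact: balancing_sym_avg. Qed.

Lemma sym_avg_le_width G x a b : chord_below G -> 0 <= a <= b ->
  sym_avg G a x <= sym_avg G b x.
Proof.
move=> cG /andP[a0 ab].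
have [b0|b_neq0] := eqVneq b 0.
  by have -> : a = b by lra.
have b_gt0 : 0 < b by lra.
have ab' : `|a| <= b by rewrite ger0_norm.
have := cG x a b ab'; rewrite -normrN in ab'; have := cG x (- a) b ab'.
rewrite /sym_avg ler_pM2r// -(@ler_pM2l _ (2 * b)) ?mulr_gt0//.
rewrite opprK; lra.
Qed.

(** Induction on [m]: a pair exchange gives the outermost sign the size [Num.sqrt (t / m.+2%:R)],
    and the induction hypothesis equalizes the remaining [m.+1] signs. *)
Lemma sym_avg_rad_mean_le G m D t s : chord_below G -> balancing G ->
  0 <= D -> D ^+ 2 <= t ->
  sym_avg (rad_mean G m (t - D ^+ 2)) D s <= rad_mean G m.+1 t s.
Proof.
move=> cG bG; elim: m D t s => [|m IH] D t s D0 Dt.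
  (* No sign is left to use the variance [t - D ^+ 2], so the single sign is widened from [D] to
     [Num.sqrt t]. *)
  rewrite /= divr1; apply: sym_avg_le_width => //.
  by rewrite D0/= -(ger0_norm D0) -sqrtr_sqr ler_wsqrtr.
(* Trade the step sizes [D] and [Num.sqrt e2] for [Num.sqrt q] and [g], which
   makes the last step already optimal. *)
pose q := t / m.+2%:R.
pose e2 := (t - D ^+ 2) / m.+1%:R.
have t0 : 0 <= t by apply: le_trans Dt; exact: sqr_ge0.
have q0 : 0 <= q by rewrite divr_ge0.
have e0 : 0 <= e2 by rewrite divr_ge0 ?subr_ge0.
have tE : t = m.+2%:R * q by rewrite /q mulrC divfK ?pnatr_eq0.
have eE : t - D ^+ 2 = m.+1%:R * e2 by rewrite /e2 mulrC divfK ?pnatr_eq0.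
have DeE : m.+2%:R * q = m.+1%:R * e2 + D ^+ 2 by rewrite -tE -eE subrK.
set D2 := D ^+ 2 in eE DeE *.
have D20 : 0 <= D2 by exact: sqr_ge0.
have m0 : 0 <= m%:R :> R by [].
have mS : m.+1%:R = m%:R + 1 :> R by rewrite natr1.
have mSS : m.+2%:R = m%:R + 2 :> R by rewrite -[m.+2]addn2 natrD.
rewrite mS mSS in DeE eE.
have g0 : 0 <= D2 + e2 - q.
  rewrite -(@pmulr_rge0 _ (m%:R + 2)); last by lra.
  have : 0 <= (m%:R + 1) * D2 + e2 by rewrite addr_ge0// mulr_ge0//; lra.
  by lra.
(* The difference of the two sides is [(q - D2) * (e2 - q)], and [q] lies between [D2] and [e2] as a
   weighted mean of them. *)
have ge : e2 * D2 <= (D2 + e2 - q) * q.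
  have : 0 <= (m%:R + 1) * (e2 - q) ^+ 2 by rewrite mulr_ge0 ?sqr_ge0//; lra.
  have qD : q - D2 = (m%:R + 1) * (e2 - q) by lra.
  have -> : (m%:R + 1) * (e2 - q) ^+ 2 = (q - D2) * (e2 - q) by rewrite qD; ring.
  by lra.
set g := Num.sqrt (D2 + e2 - q).
have gE : g ^+ 2 = D2 + e2 - q by rewrite sqr_sqrtr.
have KE : t - D2 - e2 = t - q - g ^+ 2 by rewrite gE; ring.
rewrite [rad_mean G m.+1 _]/= -/e2 KE.
apply: (@le_trans _ _
  (sym_avg (sym_avg (rad_mean G m (t - q - g ^+ 2)) g) (Num.sqrt q) s)).
  apply: balancing_rad_mean; rewrite ?sqrtr_ge0 ?gE ?sqr_sqrtr//.
    by rewrite /D2; ring.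
  rewrite -ler_sqr ?nnegrE ?mulr_ge0 ?sqrtr_ge0// !exprMn.
  by rewrite gE !sqr_sqrtr.
rewrite [rad_mean G m.+2 _]/= -/q; apply: sym_avg_le => y.
apply: IH; rewrite ?sqrtr_ge0// gE.
have : 0 <= m%:R * e2 by rewrite mulr_ge0.
by lra.
Qed.

(** By homogeneity the bound for a square function of norm [c] reduces to total variance 1. *)
Lemma rad_mean_scale G p m c t s : 0 <= c -> 0 <= t ->
  (forall x, G (c * x) = c `^ p * G x) ->
  rad_mean G m (c ^+ 2 * t) (c * s) = c `^ p * rad_mean G m t s.
Proof.
move=> c0 t0 cG; elim: m t t0 s => //= m IH t t0 s.
rewrite -(mulrA (c ^+ 2)) -mulrBr (sqrtrM _ (sqr_ge0 c)) sqrtr_sqr ger0_norm//.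
have tm : 0 <= t - t / m.+1%:R.
  by rewrite subr_ge0 ler_pdivrMr// ler_peMr// ler1n.
by rewrite /sym_avg -mulrDr -mulrBr !IH// -mulrDr mulrA.
Qed.

End balancing.

(** * Discrete martingales *)

Local Open Scope ereal_scope.

(** * Functions constant on atoms and integration over a countable partition *)

Section partitions.
Context d (T : measurableType d) (R : realType) (P : probability T R).
Implicit Types (D : set (set T)) (V W : set T).

(** The pointwise form of measurability for the sigma-algebra generated by a partition, in which all
    conditioning below is done. *)
Definition cst_on D (U : Type) (f : T -> U) :=
  forall V, D V -> forall x y, V x -> V y -> f x = f y.

Lemma pos_partition_uniq D V W x : pos_partition P D -> D V -> D W ->
  V x -> W x -> V = W.
Proof. by move=> [_ _ _ tD] DV DW Vx Wx; apply: tD => //; exists x. Qed.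

Lemma pos_partition_cover D x : pos_partition P D -> exists2 V, D V & V x.
Proof.
move=> [_ _ DT _]; have [V DV Vx] : (\bigcup_(V in D) V) x by rewrite DT.
by exists V.
Qed.

Lemma pos_partition_neq0 D V : pos_partition P D -> D V -> V !=set0.
Proof.
move=> [_ /(_ V) + _ _] DV => /(_ DV)[_ V0]; apply/set0P/eqP => VE.
by rewrite VE measure0 ltxx in V0.
Qed.

(** The sets that contain or avoid [V] form a sigma-algebra containing [D]. *)
Lemma g_sigma_algebra_partition D A V : trivIset D id ->
  <<s D >> A -> D V -> V `<=` A \/ V `<=` ~` A.
Proof.
move=> tD DA DV; suff : [set B | V `<=` B \/ V `<=` ~` B] A by [].
move: A DA; apply: smallest_sub; last first.
  move=> W DW /=; have [[x [Vx Wx]]|VW] := pselect (V `&` W !=set0).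
    by left; rewrite (tD _ _ DV DW)//; exists x.
  by right => x Vx Wx; apply: VW; exists x.
split => [|A [VA|VA]|A VA] /=.
- by right; rewrite setC0.
- by right; rewrite setTD setCK.
- by left; rewrite setTD.
- have [[i VAi]|nVA] := pselect (exists i, V `<=` A i).
    by left => x Vx; exists i => //; exact: VAi.
  right => x Vx [i _ Aix]; case: (VA i) => VAi; first by apply: nVA; exists i.
  exact: VAi Aix.
Qed.

(** A preimage is the countable union of the atoms it contains. The lemma serves for the ambient
    sigma-algebra and for the one generated by the partition. *)
Lemma cst_on_measurable d' (U : measurableType d') D (f : T -> U) :
  countable D -> (forall V, D V -> measurable V) ->
  \bigcup_(V in D) V = [set: T] -> cst_on D f -> measurable_fun [set: T] f.
Proof.
move=> cD mD DT fD _ B mB; rewrite setTI.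
have -> : f @^-1` B = \bigcup_(V in D `&` [set V | V `<=` f @^-1` B]) V.
  apply/seteqP; split => [x Bx|x [V [_ VB] Vx]]; last exact: VB.
  have [V DV Vx] : (\bigcup_(V in D) V) x by rewrite DT.
  by exists V => //; split => // y Vy /=; rewrite (fD V DV y x).
rewrite bigcup_set_type; apply: countable_bigcupT_measurable => [|[V VD]/=].
  rewrite (eq_countable (card_setT _)); apply: sub_countable cD.
  by apply: subset_card_le; exact: subIsetl.
by have [DV _] := set_mem VD; exact: mD.
Qed.

Lemma g_sigma_algebra_cst_on D (f : T -> R) : trivIset D id ->
  @measurable_fun _ _ (g_sigma_algebraType D) R [set: T] f -> cst_on D f.
Proof.
move=> tD mf V DV x y Vx Vy.
have mfx : <<s D >> (f @^-1` [set f x]).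
  by rewrite -[_ @^-1` _]setTI; exact: mf.
have [H|H] := g_sigma_algebra_partition tD mfx DV.
  by have /esym := H y Vy.
by have /(_ erefl) := H x Vx.
Qed.

(** Indexing by [nat], padded with empty sets, lets an integral be split into a series over the
    atoms. *)
Lemma pos_partition_enum D : pos_partition P D -> exists e : nat -> set T,
  [/\ trivIset setT e, \bigcup_k e k = setT & forall k, e k = set0 \/ D (e k)].
Proof.
move=> [/countable_injP[g gI] _ DT tD].
exists (fun k => \bigcup_(V in D `&` [set V | g V = k]) V); split.
- by move=> i j _ _ [x [[V [DV <-] Vx] [W [DW <-] Wx]]];
    rewrite (tD _ _ DV DW)//; exists x.
- apply/seteqP; split => // x _.
  have [V DV Vx] : (\bigcup_(V in D) V) x by rewrite DT.
  by exists (g V) => //; exists V.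
- move=> k; have [[V [DV gV]]|nV] := pselect (exists V, D V /\ g V = k).
    right; rewrite [X in D X](_ : _ = V)//.
    apply/seteqP; split => [x [W [DW gW] Wx]|x Vx]; last by exists V.
    by rewrite (gI V W) ?inE// gV gW.
  by left; apply/seteqP; split => // x [V [DV gV] _]; apply: nV; exists V.
Qed.

Lemma le_integral_partition D (f g : T -> \bar R) : pos_partition P D ->
  measurable_fun setT f -> measurable_fun setT g ->
  (forall x, 0 <= f x) -> (forall x, 0 <= g x) ->
  (forall V, D V -> \int[P]_(x in V) f x <= \int[P]_(x in V) g x) ->
  \int[P]_x f x <= \int[P]_x g x.
Proof.
move=> DP mf mg f0 g0 fg; have [e [te eT eD]] := pos_partition_enum DP.
have me k : measurable (e k).
  by have [->//|/((let: And4 _ H _ _ := DP in H) _)[]] := eD k.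
rewrite -eT !ge0_integral_bigcup ?eT//; apply: lee_nneseries => k _.
  by move=> _; exact: integral_ge0.
by have [->|] := eD k; [rewrite !integral_set0|exact: fg].
Qed.

Lemma eq_integral_partition D (f g : T -> \bar R) : pos_partition P D ->
  measurable_fun setT f -> measurable_fun setT g ->
  (forall x, 0 <= f x) -> (forall x, 0 <= g x) ->
  (forall V, D V -> \int[P]_(x in V) f x = \int[P]_(x in V) g x) ->
  \int[P]_x f x = \int[P]_x g x.
Proof.
move=> DP mf mg f0 g0 fg; apply/eqP; rewrite eq_le.
by apply/andP; split; apply: (le_integral_partition DP) => // V DV; rewrite fg.
Qed.

Lemma chord_integral V (A B : R) (f : T -> R) : measurable V ->
  P.-integrable [set: T] (EFin \o f) -> \int[P]_(x in V) (f x)%:E = 0 ->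
  \int[P]_(x in V) (A + B * f x)%:E = \int[P]_(x in V) A%:E.
Proof.
move=> mV fi f0.
have fiV : P.-integrable V (EFin \o f) by apply: integrableS fi.
under eq_integral do rewrite EFinD EFinM.
rewrite integralD//=.
- by rewrite integralZl// f0 mule0 adde0.
- exact: finite_measure_integrable_cst.
- exact: integrableZl.
Qed.

(** Bound [G] by its chord over [[s - c, s + c]], which has slope [B] and midpoint value
    [sym_avg G c s]; the linear term integrates to 0 over [V]. *)
Lemma integral_le_sym_avg G V (s c : R) (f : T -> R) :
  chord_below G -> (forall x, (0 <= G x)%R) -> measurable V ->
  P.-integrable [set: T] (EFin \o f) -> \int[P]_(x in V) (f x)%:E = 0 ->
  measurable_fun V (fun x => G (s + f x)%R) ->
  (forall x, V x -> (`|f x| <= c)%R) ->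
  \int[P]_(x in V) (G (s + f x))%:E <= \int[P]_(x in V) (sym_avg G c s)%:E.
Proof.
move=> cG G0 mV fi f0 mGf fc.
have fiV : P.-integrable V (EFin \o f) by apply: integrableS fi.
pose B := ((G (s + c) - G (s - c)) / (2 * c))%R.
have GB x : V x -> (G (s + f x) <= sym_avg G c s + B * f x)%R.
  move=> Vx; have fxc := fc x Vx.
  have [c0|c0] := eqVneq c 0%R.
    have -> : f x = 0%R by apply/eqP; rewrite -normr_le0 -c0.
    by rewrite /sym_avg c0 oppr0 !addr0 mulr0; lra.
  have c_gt0 : (0 < c)%R by rewrite lt_neqAle eq_sym c0 (le_trans _ fxc).
  rewrite -(@ler_pM2l _ (2 * c)%R) ?mulr_gt0//; apply: le_trans (cG s _ _ fxc) _.
  by rewrite le_eqVlt; apply/orP; left; apply/eqP; rewrite /B /sym_avg; field.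
rewrite -(chord_integral (sym_avg G c s) B mV fi f0).
apply: ge0_le_integral => //.
- by move=> x _; rewrite lee_fin.
- exact/measurable_EFinP.
- apply/measurable_EFinP; apply: measurable_funD => //.
  apply: measurable_funM => //; apply/measurable_EFinP.
  by case/integrableP : fiV.
Qed.

(** Only the values [c] and [- c] occur, and there the chord meets the graph of [G]. *)
Lemma integral_eq_sym_avg G V (s c : R) (f : T -> R) :
  measurable V ->
  P.-integrable [set: T] (EFin \o f) -> \int[P]_(x in V) (f x)%:E = 0 ->
  (forall x, V x -> `|f x|%R = c) ->
  \int[P]_(x in V) (G (s + f x))%:E = \int[P]_(x in V) (sym_avg G c s)%:E.
Proof.
move=> mV fi f0 fc.
pose B := ((G (s + c) - G (s - c)) / (2 * c))%R.
rewrite -(chord_integral (sym_avg G c s) B mV fi f0).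
apply: eq_integral => x; rewrite inE => Vx; congr EFin.
have [c0|c0] := eqVneq c 0%R.
  have -> : f x = 0%R by apply/eqP; rewrite -normr_eq0 -c0 fc.
  by rewrite /sym_avg c0 oppr0 !addr0 mulr0; lra.
have [fx|fx] : f x = c \/ f x = (- c)%R.
  have /eqP := fc x Vx; rewrite eqr_norml.
  by case/andP => /orP[]/eqP ->; [left|right].
- by rewrite /B /sym_avg fx; field.
- by rewrite /B /sym_avg fx; field.
Qed.

End partitions.

(** * Backward induction along a discrete filtration *)

Section filtrations.
Context d (T : measurableType d) (R : realType) (P : probability T R).
Variable D : nat -> set (set T).
Hypothesis filtD : discrete_filtration P D.
Implicit Types (V W : set T) (j k n m : nat).

Lemma filtration_partition k : pos_partition P (D k).
Proof. by case: filtD. Qed.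

Lemma filtration_measurable k V : D k V -> measurable V.
Proof. by move=> DV; have [_ /(_ V DV)[]] := filtration_partition k. Qed.

(** A point of [W] lies in some [V] of [D k]. Since [V] is a union of atoms of [D k.+1], the one
    through that point must be [W]. *)
Lemma filtration_refine k W : D k.+1 W -> exists2 V, D k V & W `<=` V.
Proof.
move=> DW; have [x Wx] := pos_partition_neq0 (filtration_partition _) DW.
have [V DV Vx] := pos_partition_cover x (filtration_partition k).
exists V => //; have [_ _ /(_ _ _ DV)[E ED VE]] := filtD.
move: Vx; rewrite VE => -[U EU Ux].
rewrite (pos_partition_uniq (filtration_partition _) DW (ED _ EU) Wx Ux) => y Uy.
by exists U.
Qed.

Lemma cst_on_refine (U : Type) (f : T -> U) j k : (j <= k)%N ->
  cst_on (D j) f -> cst_on (D k) f.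
Proof.
move=> /subnK <-; elim: (k - j)%N => // m IH /IH{}IH V DV x y Vx Vy.
have [W DW VW] := filtration_refine DV.
by apply: (IH W) => //; exact: VW.
Qed.

Lemma cst_on_filtration_measurable d' (U : measurableType d') k (f : T -> U) :
  cst_on (D k) f -> measurable_fun setT f.
Proof.
have [cD mD DT _] := filtration_partition k.
by apply: cst_on_measurable => // V /mD[].
Qed.

Section difference_sequences.
Variables (n : nat) (f : nat -> T -> R).
Hypothesis fD : forall k, (1 <= k <= n)%N -> cst_on (D k) (f k).
Hypothesis fi : forall k, (1 <= k <= n)%N ->
  P.-integrable [set: T] (EFin \o f k).
Hypothesis f0 : forall k, (1 <= k <= n)%N ->
  forall V, D k.-1 V -> \int[P]_(x in V) (f k x)%:E = 0.

Let S k x : R := (\sum_(1 <= j < k.+1) f j x)%R.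

Let S_cst k : (k <= n)%N -> cst_on (D k) (S k).
Proof.
move=> kn V DV x y Vx Vy; apply: eq_big_nat => j /andP[j1 jk].
apply: (@cst_on_refine _ (f j) j k _ _ V) => //.
by apply: fD; rewrite j1 (leq_trans _ kn).
Qed.

Let SS k x : S k.+1 x = (S k x + f k.+1 x)%R.
Proof. by rewrite /S big_nat_recr. Qed.

Variables (G : R -> R) (t : R).
Hypothesis G0 : forall x, (0 <= G x)%R.

Lemma rad_mean_upper_bound (M : nat -> T -> R) :
  chord_below G -> balancing G ->
  (forall k, (1 <= k <= n)%N -> cst_on (D k.-1) (M k)) ->
  (forall k x, (1 <= k <= n)%N -> (`|f k x| <= M k x)%R) ->
  (forall x, (\sum_(1 <= k < n.+1) M k x ^+ 2 <= t)%R) ->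
  \int[P]_x (G (\sum_(1 <= k < n.+1) f k x))%:E <= (rad_mean G n t 0)%:E.
Proof.
move=> cG bG MD fM Mt.
pose Q k x : R := (\sum_(1 <= j < k.+1) M j x ^+ 2)%R.
have QS k x : Q k.+1 x = (Q k x + M k.+1 x ^+ 2)%R by rewrite /Q big_nat_recr.
(* The majorants are predictable: the variance used up to step [k.+1] is already known on the atoms
   of [D k]. *)
have Q_cst k : (k < n)%N -> cst_on (D k) (Q k.+1).
  move=> kn V DV x y Vx Vy; apply: eq_big_nat => j /andP[j1 jk].
  rewrite (@cst_on_refine _ (M j) j.-1 k _ _ V DV x y)//.
    by rewrite -ltnS prednK.
  by apply: MD; rewrite j1 (leq_trans _ kn).
(* [Z k] is the mean that results if the remaining [n - k] increments are
   signs sharing the unused variance [t - Q k] equally. *)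
pose Z k x := rad_mean G (n - k) (t - Q k x) (S k x).
have Z_cst k : (k <= n)%N -> cst_on (D k) (Z k).
  move=> kn V DV x y Vx Vy; rewrite /Z (S_cst kn DV Vx Vy); congr rad_mean.
  congr (_ - _)%R; case: k kn DV => [|k] kn DV.
    by rewrite /Q !big_geq.
  by apply: (@cst_on_refine _ (Q k.+1) k k.+1 _ _ V) => //; exact: Q_cst.
have step k : (k < n)%N -> \int[P]_x (Z k.+1 x)%:E <= \int[P]_x (Z k x)%:E.
  move=> kn; apply: (le_integral_partition (filtration_partition k)).
  - apply/measurable_EFinP; exact: cst_on_filtration_measurable (Z_cst _ kn).
  - apply/measurable_EFinP; exact: cst_on_filtration_measurable (Z_cst _ (ltnW kn)).
  - by move=> x; rewrite lee_fin; exact: rad_mean_ge0.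
  - by move=> x; rewrite lee_fin; exact: rad_mean_ge0.
  move=> V DV; have [x0 Vx0] := pos_partition_neq0 (filtration_partition k) DV.
  have mV := filtration_measurable DV.
  have kn1 : (1 <= k.+1 <= n)%N by [].
  pose H := rad_mean G (n - k.+1) (t - Q k.+1 x0).
  have ZE x : V x -> Z k.+1 x = H (S k x0 + f k.+1 x)%R.
    move=> Vx; rewrite /Z /H SS (Q_cst k kn V DV x x0)//.
    by rewrite (S_cst (ltnW kn) DV Vx Vx0).
  rewrite (@eq_integral _ _ _ _ V
    (fun x => (H (S k x0 + f k.+1 x))%:E))//; last first.
    by move=> x /set_mem Vx; rewrite ZE.
  (* Convexity first replaces [f k.+1] by a sign of size [M k.+1 x0]; balancing then merges this
     sign with the equal ones. *)
  apply: (@le_trans _ _ (\int[P]_(x in V) (sym_avg H (M k.+1 x0) (S k x0))%:E)).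
    apply: integral_le_sym_avg => //.
    - exact: chord_below_rad_mean.
    - by move=> x; exact: rad_mean_ge0.
    - exact: fi.
    - exact: f0.
    - apply: (@eq_measurable_fun _ _ _ _ _ (Z k.+1)).
        by move=> x /set_mem Vx; rewrite ZE.
      apply: measurable_funTS.
      exact: cst_on_filtration_measurable (Z_cst _ kn).
    - move=> x Vx; rewrite -(MD _ kn1 V DV x x0)//; exact: fM.
  apply: ge0_le_integral => //.
  - by move=> x _; rewrite lee_fin /sym_avg divr_ge0 ?addr_ge0 ?rad_mean_ge0.
  - apply/measurable_EFinP; apply: measurable_funTS.
    exact: cst_on_filtration_measurable (Z_cst _ (ltnW kn)).
  move=> x Vx; rewrite lee_fin (Z_cst _ (ltnW kn) V DV x x0)//.
  rewrite /Z /H QS opprD addrA -(subnSK kn).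
  apply: sym_avg_rad_mean_le => //.
    by rewrite (le_trans _ (fM _ x0 kn1)).
  rewrite lerBrDl -QS; apply: le_trans (Mt x0).
  rewrite /Q [leRHS](big_cat_nat _ (n := k.+2))//= lerDl.
  by apply: sumr_ge0 => j _; exact: sqr_ge0.
have ZI k : (k <= n)%N -> \int[P]_x (Z k x)%:E <= \int[P]_x (Z 0%N x)%:E.
  elim: k => // k IH kn; exact: le_trans (step _ kn) (IH (ltnW kn)).
have := ZI n (leqnn n); rewrite /Z subnn subn0 /=.
rewrite /Q /S; under [leRHS]eq_integral do rewrite !big_geq// subr0.
by rewrite integral_cst// [X in _ * X]probability_setT mule1.
Qed.

(** The increments already have the optimal constant size, so each step of the backward induction is
    an equality. *)
Lemma rad_mean_eq : (forall k x, (1 <= k <= n)%N ->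
    `|f k x|%R = Num.sqrt (t / n%:R)) ->
  \int[P]_x (G (\sum_(1 <= k < n.+1) f k x))%:E = (rad_mean G n t 0)%:E.
Proof.
move=> fc.
(* This is the variance left after [k] equal shares. Divided by the [n - k] remaining steps it is
   again [t / n%:R], so [rad_mean] always uses the size of the actual increment. *)
pose u k : R := (t - k%:R * (t / n%:R))%R.
pose Z k x := rad_mean G (n - k) (u k) (S k x).
have Z_cst k : (k <= n)%N -> cst_on (D k) (Z k).
  by move=> kn V DV x y Vx Vy; rewrite /Z (S_cst kn DV Vx Vy).
have step k : (k < n)%N -> \int[P]_x (Z k.+1 x)%:E = \int[P]_x (Z k x)%:E.
  move=> kn; apply: (eq_integral_partition (filtration_partition k)).
  - apply/measurable_EFinP; exact: cst_on_filtration_measurable (Z_cst _ kn).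
  - apply/measurable_EFinP; exact: cst_on_filtration_measurable (Z_cst _ (ltnW kn)).
  - by move=> x; rewrite lee_fin; exact: rad_mean_ge0.
  - by move=> x; rewrite lee_fin; exact: rad_mean_ge0.
  move=> V DV; have [x0 Vx0] := pos_partition_neq0 (filtration_partition k) DV.
  have mV := filtration_measurable DV.
  have kn1 : (1 <= k.+1 <= n)%N by [].
  pose H := rad_mean G (n - k.+1) (u k.+1).
  rewrite (@eq_integral _ _ _ _ V
    (fun x => (H (S k x0 + f k.+1 x))%:E))//; last first.
    move=> x /set_mem Vx; rewrite /Z /H SS.
    by rewrite (S_cst (ltnW kn) DV Vx Vx0).
  rewrite (@integral_eq_sym_avg _ _ _ P H V (S k x0) (Num.sqrt (t / n%:R)))//.
  - apply: eq_integral => x /set_mem Vx; rewrite /Z (S_cst (ltnW kn) DV Vx Vx0).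
    have n0 : (n%:R != 0 :> R)%R by rewrite pnatr_eq0 -lt0n (leq_ltn_trans _ kn).
    have nk0 : ((n - k)%:R != 0 :> R)%R by rewrite pnatr_eq0 subn_eq0 -ltnNge.
    have uE : (u k / (n - k)%:R)%R = (t / n%:R)%R.
      rewrite /u natrB ?(ltnW kn)//; field; rewrite n0/=.
      by rewrite -natrB ?(ltnW kn).
    rewrite -[in X in rad_mean G X](subnSK kn)/= subnSK// uE /H.
    congr (sym_avg (rad_mean _ _ _) _ _)%:E.
    by rewrite /u -natr1; ring.
  - exact: fi.
  - exact: f0.
  - by move=> x _; exact: fc.
have ZI k : (k <= n)%N -> \int[P]_x (Z k x)%:E = \int[P]_x (Z 0%N x)%:E.
  by elim: k => // k IH kn; rewrite step// IH// ltnW.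
have := ZI n (leqnn n); rewrite /Z subnn subn0 /= => ->.
rewrite /u /S; under eq_integral do rewrite !big_geq// mul0r subr0.
by rewrite integral_cst// [X in _ * X]probability_setT mule1.
Qed.

End difference_sequences.
End filtrations.

(** * From essential suprema to the upper bound on the ratio *)

Section martingale_bounds.
Context d (T : measurableType d) (R : realType) (P : probability T R).
Implicit Types (V W : set T) (j k n m : nat) (p : R) (f : nat -> T -> R).

(** Atoms have positive measure, so an almost sure bound on a function constant on atoms holds
    everywhere: one good point per atom suffices. *)
Lemma ae_exists (Q : T -> Prop) V : {ae P, forall x, Q x} -> measurable V ->
  0 < P V -> exists2 x, V x & Q x.
Proof.
move=> [N [mN N0 QN]] mV V0; apply: contrapT => VQ.
suff : P V <= 0 by rewrite leNgt V0.
rewrite -N0; apply: le_measure; rewrite ?inE// => x Vx.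
by apply: QN => /= Qx; apply: VQ; exists x.
Qed.

Lemma LnormE p (g : T -> R) :
  'N[P]_p%:E[(fun x => (g x)%:E)] = (\int[P]_x (norm_pow p (g x))%:E) `^ p^-1.
Proof. by rewrite unlock. Qed.

Variable D : nat -> set (set T).
Hypothesis filtD : discrete_filtration P D.

Lemma majorantE f k V x : D k.-1 V -> V x ->
  majorant P D f k x = 'N[P]_+oo[(fun y => (\1_V y * f k y)%:E)].
Proof.
move=> DV Vx; rewrite /majorant (esumID [set V])//; last first.
  by move=> W DW; rewrite mule_ge0 ?Lnorm_ge0 ?lee_fin.
rewrite setIidr; last by move=> W ->.
rewrite esum_set1; last by rewrite mule_ge0 ?Lnorm_ge0 ?lee_fin.
rewrite esum1 => [|W [DW /= WV]].
  by rewrite adde0 indicE mem_set// mule1.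
rewrite indicE memNset ?mule0// => Wx; apply: WV.
exact: pos_partition_uniq (filtration_partition filtD _) DW DV Wx Vx.
Qed.

Lemma majorant_ge0 f k x : 0 <= majorant P D f k x.
Proof. by apply: esum_ge0 => V _; rewrite mule_ge0 ?Lnorm_ge0 ?lee_fin. Qed.

Lemma majorant_cst f k : cst_on (D k.-1) (majorant P D f k).
Proof. by move=> V DV x y Vx Vy; rewrite !(majorantE _ DV). Qed.

Lemma Lnormy_ge_exists (g : T -> \bar R) V : measurable V -> 0 < P V ->
  exists2 x, V x & `|g x| <= 'N[P]_+oo[g].
Proof.
move=> mV V0; rewrite unlock [X in 0 < X]probability_setT lte01.
exact: ae_exists (ess_sup_ge P (abse \o g)) mV V0.
Qed.

(** The square function is constant on the atoms of [D n.-1], so its essential supremum bounds it at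
    every point. *)
Lemma square_function_le f n x :
  square_function P D n f x <= 'N[P]_+oo[square_function P D n f].
Proof.
have [V DV Vx] := pos_partition_cover x (filtration_partition filtD n.-1).
have [_ /(_ V DV)[mV V0] _ _] := filtration_partition filtD n.-1.
have [y Vy] := Lnormy_ge_exists (square_function P D n f) mV V0.
apply: le_trans; rewrite gee0_abs; last exact: sqrte_ge0.
rewrite le_eqVlt; apply/orP; left; apply/eqP; congr sqrte.
apply: eq_big_nat => k /andP[k1 kn]; congr (_ ^+ 2).
have kn' : (k.-1 <= n.-1)%N by rewrite -!subn1 leq_sub2r.
exact: (cst_on_refine filtD kn' (@majorant_cst f k) DV Vx Vy).
Qed.

(** The atom [W] of [D k] through [x] has positive measure and lies in the atom [V] of [D k.-1] on
    which the majorant is taken. *)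
Lemma norm_le_majorant f k x : (1 <= k)%N -> cst_on (D k) (f k) ->
  `|(f k x)%:E| <= majorant P D f k x.
Proof.
move=> k1; rewrite -{1}(prednK k1) => fk.
have [W DW Wx] := pos_partition_cover x (filtration_partition filtD k.-1.+1).
have [V DV WV] := filtration_refine filtD DW.
have [_ /(_ W DW)[mW W0] _ _] := filtration_partition filtD k.-1.+1.
rewrite (majorantE f DV (WV _ Wx)).
have [y Wy] := Lnormy_ge_exists (fun y => (\1_V y * f k y)%:E) mW W0.
apply: le_trans; rewrite indicE mem_set; last exact: WV.
by rewrite mul1r (fk W DW x y).
Qed.

Lemma mart_diff_seq_cst_on f n k : mart_diff_seq P D n f ->
  (1 <= k <= n)%N -> cst_on (D k) (f k).
Proof.
move=> fn /fn[_ mf _]; apply: g_sigma_algebra_cst_on mf.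
by have [] := filtration_partition filtD k.
Qed.

Lemma mart_ratio_le p n f : (3 <= p)%R -> (1 <= n)%N ->
  mart_diff_seq P D n f -> 0 < 'N[P]_+oo[square_function P D n f] < +oo ->
  mart_ratio P p D n f <= (rad_mean (norm_pow p) n 1 0 `^ p^-1)%:E.
Proof.
move=> p3 n1 fn; rewrite /mart_ratio; have := @square_function_le f n.
case: 'N[P]_+oo[_] => [s|_|]; [|by rewrite ltxx andbF|by rewrite ltNge leNye].
rewrite lte_fin => Ss /andP[s0 _].
have p0 : (0 < p)%R by rewrite (lt_le_trans _ p3).
have maj_le x : \sum_(1 <= k < n.+1) majorant P D f k x ^+ 2 <= (s ^+ 2)%:E.
  rewrite -lee_sqrt ?lee_fin ?sqr_ge0//.
  by apply: le_trans (Ss x) _; rewrite /= sqrtr_sqr gtr0_norm.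
(* An infinite majorant would make the sum of squares infinite, against [maj_le]; so [fine] below
   loses nothing. *)
have maj_fin k x : (1 <= k <= n)%N -> majorant P D f k x \is a fin_num.
  move=> /andP[k1 kn]; rewrite ge0_fin_numE ?majorant_ge0//.
  rewrite ltey; apply/eqP => ky; have := maj_le x.
  rewrite (bigD1_seq k) ?mem_index_iota ?iota_uniq ?k1//= ky mulyy.
  rewrite addye ?leye_eq//.
  rewrite gt_eqF// (lt_le_trans ltNy0)// sume_ge0// => j _.
  by rewrite mule_ge0 ?majorant_ge0.
pose M k x := fine (majorant P D f k x).
have ub : \int[P]_x (norm_pow p (\sum_(1 <= k < n.+1) f k x))%:E
    <= (rad_mean (norm_pow p) n (s ^+ 2) 0)%:E.
  apply: (rad_mean_upper_bound filtD _ _ _ _ (M := M)).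
  - by move=> k kn; apply: mart_diff_seq_cst_on fn kn.
  - by move=> k /fn[].
  - by move=> k /fn[].
  - exact: norm_pow_ge0.
  - by apply: chord_below_norm_pow; rewrite (le_trans _ p3)// ler1n.
  - exact: balancing_norm_pow.
  - by move=> k _ V DV x y Vx Vy; rewrite /M (majorant_cst f DV Vx Vy).
  - move=> k x kn; rewrite -lee_fin /M fineK ?maj_fin//.
    by apply: norm_le_majorant; [case/andP: kn|exact: mart_diff_seq_cst_on fn kn].
  - move=> x; rewrite -lee_fin; apply: le_trans (maj_le x).
    rewrite -sumEFin le_eqVlt; apply/orP; left; apply/eqP.
    by apply: eq_big_nat => k kn; rewrite EFin_expe fineK// maj_fin.
rewrite inver gt_eqF// lee_pdivrMr// -EFinM LnormE.
have K0 : (0 <= rad_mean (norm_pow p) n 1 0)%R.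
  by apply: rad_mean_ge0; exact: norm_pow_ge0.
have -> : (rad_mean (norm_pow p) n 1 0 `^ p^-1 * s =
  (rad_mean (norm_pow p) n (s ^+ 2) 0) `^ p^-1)%R.
  rewrite -[in RHS](mulr1 (s ^+ 2)%R) -[in RHS](mulr0 s).
  rewrite (@rad_mean_scale _ _ p)//; last 2 first.
  - exact: ltW.
  - by move=> x; rewrite /norm_pow normrM powRM// gtr0_norm.
  by rewrite powRM ?powR_ge0// -powRrM divff ?gt_eqF// powRr1 ?(ltW s0)// mulrC.
rewrite -poweR_EFin; apply: gt0_ler_poweR => //.
- by rewrite invr_ge0 ltW.
- rewrite in_itv/= leey andbT integral_ge0// => x _.
  by rewrite lee_fin norm_pow_ge0.
- rewrite in_itv/= leey andbT lee_fin; apply: rad_mean_ge0.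
  exact: norm_pow_ge0.
Qed.

Lemma Lnorm_rad_mean p n f : (0 < p)%R ->
  mart_diff_seq P D n f ->
  (forall k x, (1 <= k <= n)%N -> `|f k x|%R = Num.sqrt (1 / n%:R)) ->
  'N[P]_p%:E[(fun x => (\sum_(1 <= k < n.+1) f k x)%:E)] =
  (rad_mean (norm_pow p) n 1 0 `^ p^-1)%:E.
Proof.
move=> p0 fn fc; rewrite LnormE (rad_mean_eq filtD _ _ _ (t := 1%R))//.
- by move=> k kn; apply: mart_diff_seq_cst_on fn kn.
- by move=> k /fn[].
- by move=> k /fn[].
- exact: norm_pow_ge0.
Qed.

End martingale_bounds.

Local Close Scope ereal_scope.

(** * Dyadic martingales *)

Section dyadic_filtration.
Variable R : realType.
Implicit Types (x y : unitI R) (j k : nat).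
Local Notation mu := (@unitI_prob R).

(** The dyadic interval of level [k] around [x], counted from 0 rather than from 1. Halving the
    index gives the parent interval, and its parity tells left from right half. *)
Definition dyadic_index k x : nat := Num.truncn (2 ^+ k * unitI_val x).

Lemma unitI_val_itv x : 0 <= unitI_val x < 1.
Proof. by have := valP x; rewrite in_itv. Qed.

Let scaled_ge0 k x : 0 <= 2 ^+ k * unitI_val x.
Proof. by have /andP[x0 _] := unitI_val_itv x; rewrite mulr_ge0// ltW. Qed.

Lemma unitI_Ico_dyadicE k j x :
  unitI_Ico (j%:R / 2 ^+ k) (j.+1%:R / 2 ^+ k) x <-> dyadic_index k x = j.
Proof.
rewrite /unitI_Ico/= ler_pdivrMr// ltr_pdivlMr// mulrC.
by split=> [/truncn_def//|<-]; exact: truncn_itv.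
Qed.

Lemma dyadic_index_lt k x : (dyadic_index k x < 2 ^ k)%N.
Proof.
rewrite truncn_lt_nat// natrX gtr_pMr//.
by have /andP[] := unitI_val_itv x.
Qed.

Lemma dyadic_indexS k x : dyadic_index k x = (dyadic_index k.+1 x)./2.
Proof.
rewrite /dyadic_index; set i := Num.truncn (2 ^+ k.+1 * _).
have /andP[ix xi] : i%:R <= 2 ^+ k.+1 * unitI_val x < i.+1%:R by exact: truncn_itv.
apply: truncn_def; have iE := odd_double_half i; rewrite exprS -mulrA in ix xi.
have h1 : i%:R = (odd i)%:R + 2 * i./2%:R :> R.
  by rewrite -[in LHS]iE natrD -mul2n natrM.
have h2 : (odd i)%:R <= 1 :> R by case: (odd i).
have h3 : 0 <= (odd i)%:R :> R by [].
by rewrite -!natr1 in ix xi *; apply/andP; split; lra.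
Qed.

Lemma dyadicE k : @dyadic R k =
  [set [set x | dyadic_index k x = j] | j in [set j | (j < 2 ^ k)%N]].
Proof.
apply/seteqP; split=> V [j /= jk <-].
  case: j jk => // j /andP[_ jk]; exists j => //=.
  by apply/seteqP; split => x /unitI_Ico_dyadicE.
exists j.+1 => //=; by apply/seteqP; split => x /unitI_Ico_dyadicE.
Qed.

Lemma measurable_unitI_val : measurable_fun setT (@unitI_val R).
Proof. by move=> _ B mB; rewrite setTI; exists B => //; rewrite setTI. Qed.

Lemma measurable_unitI_Ico (u v : R) : measurable (unitI_Ico u v).
Proof.
exists `[u, v[%classic; first exact: measurable_itv.
by rewrite setTI; apply/seteqP; split => x; rewrite /unitI_Ico/= in_itv.
Qed.

Lemma unitI_prob_Ico (u v : R) : 0 <= u -> u <= v -> v <= 1 ->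
  mu (unitI_Ico u v) = (v - u)%:E.
Proof.
move=> u0 uv v1; rewrite /mu /unitI_prob (_ : _ @` _ = `[u, v[%classic).
  rewrite lebesgue_measure_itv/= lte_fin; case: ltgtP uv => //= -> _.
  by rewrite subrr.
apply/seteqP; split => [_ [x xuv <-]|x]; first by rewrite /= in_itv.
rewrite /= in_itv/= => /andP[ux xv].
have x01 : x \in `[0, 1[ by rewrite in_itv/= (le_trans u0)//= (lt_le_trans xv).
by exists (exist _ x x01) => //; rewrite /unitI_Ico/= ux.
Qed.

Lemma dyadic_fiberE k j : [set x | dyadic_index k x = j] =
  unitI_Ico (j%:R / 2 ^+ k) (j.+1%:R / 2 ^+ k).
Proof. by apply/seteqP; split => x /unitI_Ico_dyadicE. Qed.

Lemma measurable_dyadic_fiber k j : measurable [set x | dyadic_index k x = j].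
Proof. by rewrite dyadic_fiberE; exact: measurable_unitI_Ico. Qed.

Lemma unitI_prob_dyadic_fiber k j : (j < 2 ^ k)%N ->
  mu [set x | dyadic_index k x = j] = (2 ^- k)%:E.
Proof.
move=> jk; rewrite dyadic_fiberE unitI_prob_Ico.
- by rewrite -mulrBl -natr1 addrC addKr mul1r.
- by rewrite divr_ge0// ltW.
- by rewrite ler_pM2r ?invr_gt0// ler_nat.
- by rewrite ler_pdivrMr// mul1r -natrX ler_nat.
Qed.

Lemma dyadic_partition k : pos_partition mu (@dyadic R k).
Proof.
rewrite dyadicE; split.
- exact/(sub_countable (card_image_le _ _))/countableP.
- move=> _ [j jk <-]; split; first exact: measurable_dyadic_fiber.
  by rewrite [ltRHS]unitI_prob_dyadic_fiber// lte_fin invr_gt0.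
- apply/seteqP; split => // x _.
  exists [set y | dyadic_index k y = dyadic_index k x] => //.
  by exists (dyadic_index k x) => //; exact: dyadic_index_lt.
- by move=> _ _ [i _ <-] [j _ <-] [x [/= <- <-]].
Qed.

Lemma dyadic_filtration : discrete_filtration mu (@dyadic R).
Proof.
split; first exact: dyadic_partition.
- rewrite dyadicE; have setTE : [set x | dyadic_index 0 x = 0%N] = setT.
    apply/seteqP; split => // x _ /=.
    by have := dyadic_index_lt 0 x; case: dyadic_index.
  by apply/seteqP; split => [_ [[|//] _ <-]//|_ ->]; exists 0%N.
- move=> k V; rewrite !dyadicE => -[j jk <-].
  exists [set W | [set [set x | dyadic_index k.+1 x = i] |
     i in [set i | (i < 2 ^ k.+1)%N /\ i./2 = j]] W].
    by move=> _ [i [ik _] <-]; exists i.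
  apply/seteqP; split => [x /= xj|x [_ [i [ik ij] <-]] /= xi].
    exists [set y | dyadic_index k.+1 y = dyadic_index k.+1 x] => //.
    exists (dyadic_index k.+1 x) => //; split; first exact: dyadic_index_lt.
    by rewrite -dyadic_indexS.
  by rewrite dyadic_indexS xi.
Qed.

End dyadic_filtration.

Lemma half_doubleS (m : nat) : m.*2.+1./2 = m.
Proof. by rewrite -uphalfE uphalf_double. Qed.

(** * Haar martingales through dyadic indices, and their relation to Rademacher functions *)

Section haar_martingales.
Variable R : realType.
Implicit Types (x y : unitI R) (j k n : nat) (a : nat -> R).
Local Notation mu := (@unitI_prob R).

(** The index at level [k] decides membership in the support, and the parity of the next index
    decides the sign. *)
Lemma haar_fun_dyadicE k j x : @haar_fun R k j.+1 x =
  (dyadic_index k x == j)%:R * (-1) ^+ dyadic_index k.+1 x.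
Proof.
have half1 : (j%:R : R) / 2 ^+ k = (2 * j)%:R / 2 ^+ k.+1.
  by rewrite natrM exprS -mulf_div divff// mul1r.
have half2 : (j.+1%:R : R) / 2 ^+ k = (2 * j).+2%:R / 2 ^+ k.+1.
  by rewrite -[(2 * j).+2](mulnS 2) natrM exprS -mulf_div divff// mul1r.
have e : (2 * j.+1).-1 = (2 * j).+1 by rewrite mulnS.
rewrite /haar_fun e/= half1 half2 -!dyadic_fiberE !indicE.
rewrite dyadic_indexS; set i := dyadic_index k.+1 x.
have -> : (x \in [set x | dyadic_index k.+1 x = (2 * j)%N]) = (i == (2 * j)%N).
  by apply/idP/eqP; rewrite inE.
have -> : (x \in [set x | dyadic_index k.+1 x = (2 * j).+1]) = (i == (2 * j).+1).
  by apply/idP/eqP; rewrite inE.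
clearbody i; have iE := odd_double_half i.
rewrite -signr_odd; move: iE; case: (odd i) => /=; rewrite ?add0n ?add1n => <-.
  rewrite half_doubleS -mul2n eqSS eqn_pmul2l// expr1.
  rewrite [(_.+1 == _)](_ : _ = false) ?sub0r ?mulrN1//.
  by apply/negP => /eqP/(congr1 odd); rewrite /= !oddM.
rewrite doubleK -mul2n eqn_pmul2l// expr0 mulr1.
rewrite [(_ == _.+1)](_ : _ = false) ?subr0//.
by apply/negP => /eqP/(congr1 odd); rewrite /= !oddM.
Qed.

(** The Haar functions of one level have disjoint supports, so a single term survives at [x]. *)
Lemma haar_mart_dyadicE a k x : haar_mart a k.+1 x =
  a (2 ^ k + dyadic_index k x).+1 * (-1) ^+ dyadic_index k.+1 x.
Proof.
have -> : haar_mart a k.+1 x =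
    \sum_(i < 2 ^ k) a (2 ^ k + i.+1)%N * haar (2 ^ k + i.+1) x.
  rewrite /haar_mart/= (_ : (2 ^ k.+1).+1 = (2 ^ k + (2 ^ k).+1)%N); last first.
    by rewrite expnS mul2n -addnn addnS.
  rewrite -{1}[(2 ^ k).+1]add0n big_addn addnK big_mkord.
  by apply: eq_bigr => i _; rewrite addnC addSnnS.
have haar_mE i : (i < 2 ^ k)%N -> haar (2 ^ k + i.+1) x =
    (dyadic_index k x == i)%:R * (-1) ^+ dyadic_index k.+1 x.
  by move=> ik; rewrite haarE// haar_fun_dyadicE.
rewrite (bigD1 (Ordinal (dyadic_index_lt k x)))//= big1 => [|i ix].
  by rewrite haar_mE ?dyadic_index_lt// eqxx mul1r addr0 addnS.
rewrite haar_mE// (_ : _ == _ = false) ?mul0r ?mulr0//.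
by apply: contraNF ix => /eqP ix; apply/eqP/val_inj.
Qed.

Lemma cst_on_haar_mart a k : (1 <= k)%N -> cst_on (@dyadic R k) (@haar_mart R a k).
Proof.
case: k => // k _; rewrite dyadicE => _ [j _ <-] x y /= xj yj.
by rewrite !haar_mart_dyadicE !(dyadic_indexS k) xj yj.
Qed.

Lemma haar_mart_diff_seq a n : mart_diff_seq mu (@dyadic R) n (@haar_mart R a).
Proof.
move=> k /andP[k1 kn]; have [cD mD DT _] := dyadic_partition R k.
have hc := cst_on_haar_mart a k1.
have mh : measurable_fun setT (@haar_mart R a k).
  by apply: cst_on_measurable DT hc => // V /mD[].
split.
- apply: measurable_bounded_integrable => //.
    by rewrite [ltLHS]probability_setT ltry.
  case: k k1 kn {cD mD DT hc mh} => // k _ _.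
  exists (\sum_(j < 2 ^ k) `|a (2 ^ k + j).+1|); split; first exact: num_real.
  move=> M HM x _ /=; apply: le_trans (ltW HM).
  rewrite haar_mart_dyadicE normrM normrX normrN1 expr1n mulr1.
  by rewrite (bigD1 (Ordinal (dyadic_index_lt k x)))//= lerDl sumr_ge0.
- apply: (@cst_on_measurable _ (g_sigma_algebraType (@dyadic R k)) _ R
    (@dyadic R k)) => // V DV.
  exact: sub_sigma_algebra.
- case: k k1 kn hc mh {cD mD DT} => // k _ _ hc mh V.
  rewrite /= dyadicE => -[j jk <-].
  have jE b : (b < 2)%N -> (b + j.*2 < 2 ^ k.+1)%N.
    move=> b2; rewrite expnS mul2n (@leq_trans (j.+1.*2))//; last first.
      by rewrite leq_double.
    by rewrite doubleS -addn2 addnC ltn_add2l.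
  (* The two halves have equal measure, and the increment takes opposite constant values on them. *)
  have -> : [set x : unitI R | dyadic_index k x = j] =
      ([set x | dyadic_index k.+1 x = (0 + j.*2)%N] `|`
       [set x | dyadic_index k.+1 x = (1 + j.*2)%N])%classic.
    apply/seteqP; split => x /=.
      rewrite (dyadic_indexS k) => <-; have := odd_double_half (dyadic_index k.+1 x).
      by case: odd => E; [right|left]; exact: esym E.
    rewrite (dyadic_indexS k) => -[->|->].
      by rewrite add0n doubleK.
    by rewrite add1n half_doubleS.
  rewrite integral_setU//=.
  + rewrite (eq_integral (cst (a (2 ^ k + j).+1)%:E))
      => [|x /set_mem/= xj]; last first.
      rewrite haar_mart_dyadicE (dyadic_indexS k) xj doubleK.
      by rewrite -signr_odd odd_double mulr1.
    rewrite [X in _ + X](eq_integral (cst (- a (2 ^ k + j).+1)%:E))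
      => [|x /set_mem/= xj]; last first.
      rewrite haar_mart_dyadicE (dyadic_indexS k) xj half_doubleS.
      rewrite -signr_odd /= odd_double.
      by rewrite mulrN1.
    rewrite !integral_cst; [|exact: measurable_dyadic_fiber..].
    rewrite [X in (_ * X + _)%E]unitI_prob_dyadic_fiber; last exact: jE.
    rewrite [X in (_ + _ * X)%E]unitI_prob_dyadic_fiber; last exact: jE.
    by rewrite -!EFinM mulNr -EFinD subrr.
  + exact: measurable_dyadic_fiber.
  + exact: measurable_dyadic_fiber.
  + by apply/measurable_EFinP; apply: measurable_funTS.
  + apply/disj_setPS => x [/= -> ]; rewrite add0n add1n => /(congr1 odd).
    by rewrite /= odd_double.
Qed.

Lemma measurable_rademacher k : measurable_fun setT (@rademacher R k).
Proof.
have msg : measurable_fun setT (@Num.sg R).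
  have -> : @Num.sg R = (fun z => \1_(`]0, +oo[%classic : set R) z -
                                  \1_(`]-oo, 0[%classic : set R) z).
    apply/funext => z; rewrite !indicE !mem_setE !in_itv/= andbT.
    case: (ltgtP z 0) => [z0|z0|->].
    - by rewrite ltr0_sg// sub0r.
    - by rewrite gtr0_sg// subr0.
    - by rewrite sgr0 subrr.
  by apply: measurable_funB; apply: measurable_indic; exact: measurable_itv.
apply: (measurableT_comp msg); apply: measurableT_comp.
  by apply: continuous_measurable_fun; exact: continuous_sin.
apply: measurable_funM => //; exact: measurable_unitI_val.
Qed.

Lemma sinDnpi (z : R) j : sin (z + pi *+ j) = (-1) ^+ j * sin z.
Proof.
elim: j => [|j IH]; first by rewrite addr0 mul1r.
by rewrite mulrSr addrA sinDpi IH exprS mulN1r mulNr.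
Qed.

(** Write [2 ^ k * x] as [i + z] with [i] the dyadic index. For [0 < z < 1] the sine has sign
    [(-1) ^ i], the sign of the Haar function at [x]. *)
Lemma ae_rademacher_haar a c k : (1 <= k)%N ->
  (forall j, (j < 2 ^ k.-1)%N -> a (2 ^ k.-1 + j).+1 = c) ->
  {ae mu, forall x, c * rademacher k x = haar_mart a k x}.
Proof.
case: k => // k _ ac.
(* These are the zeros of the sine, where [rademacher] is 0; they form a countable, hence null,
   set. *)
pose N := [set x : unitI R | exists i, 2 ^+ k.+1 * unitI_val x = i%:R].
have cN : countable (@unitI_val R @` N).
  apply: (@sub_countable _ _ _ ((fun i : nat => i%:R / 2 ^+ k.+1 : R) @` setT)).
    apply: subset_card_le => _ [x [i xi] <-]; exists i => //.
    by rewrite -xi mulrC mulKf ?expf_neq0.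
  exact/(sub_countable (card_image_le _ _))/countableP.
exists N; split.
- have -> : N = (@unitI_val R @^-1` (@unitI_val R @` N))%classic.
    apply/seteqP; split => [x Nx|x [y Ny /val_inj <-]//]; by exists x.
  rewrite -[_ @^-1` _]setTI; apply: measurable_unitI_val => //.
  exact: countable_measurable.
- exact: countable_lebesgue_measure0.
- move=> x /=; apply: contra_notP => Nx.
  rewrite haar_mart_dyadicE ac ?dyadic_index_lt//; congr (_ * _).
  rewrite /rademacher; set i := dyadic_index k.+1 x.
  have /andP[x0 _] := unitI_val_itv x.
  have s0 : 0 <= 2 ^+ k.+1 * unitI_val x by rewrite mulr_ge0.
  have /andP[ix xi] : i%:R <= 2 ^+ k.+1 * unitI_val x < i.+1%:R by exact: truncn_itv.
  set z := 2 ^+ k.+1 * unitI_val x - i%:R.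
  have -> : 2 ^+ k.+1 * pi * unitI_val x = z * pi + pi *+ i.
    by rewrite /z -mulr_natl; ring.
  have z0 : 0 < z.
    rewrite /z subr_gt0 lt_neqAle ix andbT; apply/eqP => E; apply: Nx.
    by exists i.
  have z1 : z < 1 by rewrite /z ltrBlDr addrC natr1.
  rewrite sinDnpi sgrM sgrX sgrN1 gtr0_sg ?mulr1//.
  by apply: sin_gt0_pi; rewrite mulr_gt0 ?pi_gt0//= gtr_pMl ?pi_gt0.
Qed.

End haar_martingales.

Local Open Scope ereal_scope.

(** * Invariance of the ratio under almost everywhere equality *)

Section ae_invariance.
Context d (T : measurableType d) (R : realType) (P : probability T R).
Variables (D : nat -> set (set T)) (n : nat) (f g : nat -> T -> R).
Hypothesis fg : forall k, (1 <= k <= n)%N -> {ae P, forall x, f k x = g k x}.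

(** The increments enter only through essential suprema, which makes this an equality at every
    point. *)
Lemma ae_eq_square_function : square_function P D n f = square_function P D n g.
Proof.
apply/funext => x; congr sqrte; apply: eq_big_nat => k kn; congr (_ ^+ 2).
apply: eq_esum => V _; congr (_ * _); rewrite unlock; congr (if _ then _ else _).
by apply: eq_ess_sup; apply: filterS (fg kn) => y /= ->.
Qed.

Hypothesis mf : forall k, (1 <= k <= n)%N -> measurable_fun setT (f k).
Hypothesis mg : forall k, (1 <= k <= n)%N -> measurable_fun setT (g k).

Lemma ae_eq_Lnorm_sum p :
  'N[P]_p%:E[(fun x => (\sum_(1 <= k < n.+1) f k x)%:E)] =
  'N[P]_p%:E[(fun x => (\sum_(1 <= k < n.+1) g k x)%:E)].
Proof.
have msum (h : nat -> T -> R) :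
    (forall k, (1 <= k <= n)%N -> measurable_fun setT (h k)) ->
    measurable_fun setT (fun x => (norm_pow p (\sum_(1 <= k < n.+1) h k x))%:E).
  move=> mh; apply/measurable_EFinP.
  apply: (measurableT_comp (measurable_powR p)); apply: measurableT_comp => //.
  suff H m : (m <= n)%N ->
      measurable_fun setT (fun x => (\sum_(1 <= k < m.+1) h k x)%R) by exact: H.
  elim: m => [_|m IH mn].
    by under eq_fun do rewrite big_geq//; exact: measurable_cst.
  under eq_fun do rewrite big_nat_recr//=.
  by apply: measurable_funD; [exact: IH (ltnW mn)|exact: mh].
rewrite !LnormE; congr (_ `^ _); apply: ae_eq_integral => //.
- exact: msum.
- exact: msum.
have : {ae P, forall x k, (1 <= k <= n)%N -> f k x = g k x}.
  apply: ae_foralln => k; have [kn|kn] := boolP (1 <= k <= n)%N.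
    by apply: filterS (fg kn) => x ->.
  exact: aeW.
apply: filterS => x H _; congr (norm_pow _ _)%:E.
by apply: eq_big_nat => k kn; apply: H.
Qed.

Lemma ae_eq_mart_ratio p : mart_ratio P p D n f = mart_ratio P p D n g.
Proof. by rewrite /mart_ratio ae_eq_square_function ae_eq_Lnorm_sum. Qed.

End ae_invariance.

(** * Rademacher martingales as Haar martingales, and constant coefficients *)

Section rademacher_haar.
Variable R : realType.
Implicit Types (x : unitI R) (j k n : nat) (a : nat -> R).
Local Notation mu := (@unitI_prob R).

Lemma measurable_rademacher_mart a k : measurable_fun setT (@rademacher_mart R a k).
Proof. by apply: measurable_funM => //; exact: measurable_rademacher. Qed.

Lemma measurable_haar_mart a k : (1 <= k)%N ->
  measurable_fun setT (@haar_mart R a k).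
Proof.
move=> k1.
exact: (cst_on_filtration_measurable (dyadic_filtration R)
  (cst_on_haar_mart a k1)).
Qed.

Lemma ae_rademacher_mart_haar_mart a : exists b : nat -> R, forall k, (1 <= k)%N ->
  {ae mu, forall x, rademacher_mart a k x = haar_mart b k x}.
Proof.
(* All Haar coefficients with [2 ^ k < m <= 2 ^ k.+1] receive the value [a k.+1]. *)
exists (fun m => a (trunc_log 2 m.-1).+1) => -[//|k] _.
apply: ae_rademacher_haar => // j jk /=.
rewrite (@trunc_log_eq 2 k)//.
by rewrite leq_addr/= expnS mul2n -addnn ltn_add2l.
Qed.

Lemma norm_haar_mart_cst (c : R) k x : (0 <= c)%R -> (1 <= k)%N ->
  `|haar_mart (fun=> c) k x|%R = c.
Proof.
case: k => // k c0 _; rewrite haar_mart_dyadicE normrM normrX normrN1 expr1n.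
by rewrite mulr1 ger0_norm.
Qed.

Lemma square_function_haar_cst (c : R) n x : (0 <= c)%R ->
  square_function mu (@dyadic R) n (@haar_mart R (fun=> c)) x =
  (Num.sqrt (n%:R * c ^+ 2))%:E.
Proof.
move=> c0; have maj k : (1 <= k)%N ->
    majorant mu (@dyadic R) (@haar_mart R (fun=> c)) k x = c%:E.
  move=> k1; have [V DV Vx] := pos_partition_cover x (dyadic_partition R k.-1).
  rewrite (majorantE (dyadic_filtration R) _ DV Vx).
  have [_ /(_ V DV)[mV V0] _ _] := dyadic_partition R k.-1.
  apply/eqP; rewrite eq_le; apply/andP; split.
    rewrite unlock ifT; last by rewrite [ltRHS]probability_setT lte01.
    apply/ess_supP; apply: aeW => y /=.
    rewrite normrM norm_haar_mart_cst// lee_fin indicE.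
    by case: (y \in V); rewrite ?normr1 ?normr0 ?mul1r ?mul0r.
  have [y Vy] :=
    Lnormy_ge_exists (fun y => (\1_V y * haar_mart (fun=> c) k y)%:E) mV V0.
  apply: le_trans; rewrite indicE mem_set// mul1r.
  by rewrite abse_EFin norm_haar_mart_cst.
rewrite /square_function (eq_big_nat _ _ (F2 := fun=> (c ^+ 2)%:E))
  => [|k /andP[k1 _]]; last first.
  by rewrite maj.
by rewrite sumEFin sumr_const_nat subSS subn0 /= mulr_natl.
Qed.

End rademacher_haar.

Local Close Scope ereal_scope.

(** * Equality of the three constants *)

Theorem theorem1p2 (R : realType) (p : R) (n : nat) :
  3 <= p -> (1 <= n)%N ->
  [/\ A_const p n = A_Haar p n,
      A_Haar p n = A_Rademacher p n &
      A_Rademacher p n =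
        ('N[@unitI_prob R]_p%:E[(fun x =>
           ((Num.sqrt n%:R)^-1 * \sum_(1 <= k < n.+1) rademacher k x)%:E)])%E].
Proof.
move=> p3 n1; set C := ('N[_]_ _[_])%E; pose c : R := (Num.sqrt n%:R)^-1.
have p0 : 0 < p by rewrite (lt_le_trans _ p3).
have n0 : 0 < n%:R :> R by rewrite ltr0n.
have c0 : 0 <= c by rewrite invr_ge0 sqrtr_ge0.
have c2 : c ^+ 2 = n%:R^-1 by rewrite exprVn sqr_sqrtr// ltW.
have radE : C = ('N[@unitI_prob R]_p%:E[(fun x =>
    (\sum_(1 <= k < n.+1) rademacher_mart (fun=> c) k x)%:E)])%E.
  by apply: eq_Lnorm => x; rewrite mulr_sumr.
have rad_haar k : (1 <= k <= n)%N -> {ae @unitI_prob R, forall x,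
    rademacher_mart (fun=> c) k x = haar_mart (fun=> c) k x}.
  by move=> /andP[k1 _]; exact: ae_rademacher_haar.
have mrad (a : nat -> R) k : (1 <= k <= n)%N ->
    measurable_fun setT (rademacher_mart a k).
  by move=> _; exact: measurable_rademacher_mart.
have mhaar (a : nat -> R) k : (1 <= k <= n)%N ->
    measurable_fun setT (haar_mart a k).
  by move=> /andP[k1 _]; exact: measurable_haar_mart.
have CE : C = (rad_mean (norm_pow p) n 1 0 `^ p^-1)%:E.
  rewrite radE (ae_eq_Lnorm_sum rad_haar)//; try exact: mrad; try exact: mhaar.
  apply: (Lnorm_rad_mean (dyadic_filtration R)) => //.
    exact: haar_mart_diff_seq.
  move=> k x /andP[k1 _].
  by rewrite norm_haar_mart_cst// div1r -c2 sqrtr_sqr ger0_norm.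
(* First link of the cycle [C <= A_Rademacher <= A_Haar <= A_const <= C]. Equal coefficients [c] are
   the witness, as their square function is 1 everywhere. *)
have C_le : (C <= A_Rademacher p n)%E.
  have sqE : ('N[@unitI_prob R]_+oo[square_function (@unitI_prob R)
      (@dyadic R) n (rademacher_mart (fun=> c))] = 1)%E.
    rewrite (ae_eq_square_function _ rad_haar).
    rewrite (_ : square_function _ _ _ _ = cst 1%E); last first.
      apply/funext => x; rewrite square_function_haar_cst// c2 divff ?gt_eqF//.
      by rewrite sqrtr1.
    rewrite unlock ifT; last by rewrite [ltRHS]probability_setT lte01.
    rewrite (_ : _ \o _ = cst 1%E) ?ess_sup_cst//.
      by rewrite [ltRHS]probability_setT lte01.
    by apply/funext => x /=; rewrite normr1.
  apply: ereal_sup_ubound; exists (rademacher_mart (fun=> c)).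
    by split; [exists (fun=> c)|rewrite sqE lte01 ltry].
  by rewrite /mart_ratio sqE inve1 mule1 -radE.
have Rad_le : (A_Rademacher p n <= A_Haar p n)%E.
  apply: ge_ereal_sup => _ [_ [[a _ <-] Sa] <-].
  (* Because of the zeros of the sine, a Rademacher martingale is a Haar martingale only almost
     everywhere, which preserves the ratio. *)
  have [b ab] := ae_rademacher_mart_haar_mart a.
  have ab' k : (1 <= k <= n)%N -> {ae @unitI_prob R, forall x,
    rademacher_mart a k x = haar_mart b k x}.
    by move=> /andP[k1 _]; exact: ab.
  apply: ereal_sup_ubound; exists (haar_mart b).
    by split; [exists b|rewrite -(ae_eq_square_function _ ab')].
  by rewrite (ae_eq_mart_ratio _ ab' (mrad a) (mhaar b)).
have Haar_le : (A_Haar p n <= A_const p n)%E.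
  apply: ge_ereal_sup => _ [_ [[b _ <-] Sb] <-].
  apply: ereal_sup_ubound; exists _, (unitI R), (@unitI_prob R), (@dyadic R).
  split; first exact: dyadic_filtration.
  by exists (haar_mart b) => //; split => //; exact: haar_mart_diff_seq.
have const_le : (A_const p n <= C)%E.
  apply: ge_ereal_sup => _ [d [T [P [D [filtD [f [fn Sf] <-]]]]]].
  by rewrite CE; exact: mart_ratio_le.
have HR : A_Haar p n = A_Rademacher p n.
  by apply/eqP; rewrite eq_le Rad_le andbT (le_trans Haar_le)// (le_trans const_le).
have RC : A_Rademacher p n = C.
  by apply/eqP; rewrite eq_le C_le andbT -HR (le_trans Haar_le).
by split=> //; apply/eqP; rewrite eq_le Haar_le andbT HR RC.
Qed.
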